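(* Let $n\ge5$ and let $A\in\mathbb{R}^{n\times n}$ be the clamped-clamped matrix defined in the context. For $p\in\{1,2,\infty\}$, $$\|A^{-1}\|_p\le \frac{(n+1)^2\bigl((n+1)^2+8\bigr)}{384}.$$ If $n$ is odd, then equality holds for $p\in\{1,\infty\}$.
   Context: The clamped-clamped matrix $A=[a_{i,j}]_{i,j=1}^n$ is the symmetric pentadiagonal matrix whose nonzero entries are: $a_{1,1}=a_{n,n}=7$; $a_{i,i}=6$ for $2\le i\le n-1$; $a_{i,i+1}=a_{i+1,i}=-4$ for $1\le i\le n-1$; $a_{i,i+2}=a_{i+2,i}=1$ for $1\le i\le n-2$. All other entries are $0$. The matrix $A$ is symmetric positive definite, hence nonsingular. $\|\cdot\|_p$ denotes the matrix norm induced by the vector $p$-norm. *)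

(* Defs.v *)
From HB Require Import structures.
From mathcomp Require Import all_boot all_order all_algebra.
From mathcomp Require Import all_classical all_reals all_analysis.
Set Implicit Arguments.
Unset Strict Implicit.
Unset Printing Implicit Defensive.
Import Order.TTheory GRing.Theory Num.Theory.
Local Open Scope classical_set_scope.
Local Open Scope ring_scope.

(* Rows and columns are numbered from 0, so the corner entries equal to 7 are
   those of index 0 and n - 1. *)
Definition clamped_mx (R : realType) (n : nat) : 'M[R]_n :=
  \matrix_(i < n, j < n)
    if i == j then (if (i == 0%N :> nat) || (i.+1 == n) then 7 else 6)
    else if (i.+1 == j) || (j.+1 == i) then - 4
    else if (i.+2 == j) || (j.+2 == i) then 1
    else 0.

(* Meaningful for 1 <= p <= +oo; the value at -oo is a dummy. *)
Definition vec_norm (R : realType) (n : nat) (p : \bar R) (x : 'cV[R]_n) : R :=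
  match p with
  | r%:E => (\sum_(i < n) `|x i 0| `^ r) `^ r^-1
  | +oo%E => \big[Num.max/0]_(i < n) `|x i 0|
  | -oo%E => 0
  end.

(* For 1 <= p <= +oo and n > 0 the set of quotients is nonempty and bounded, so
   that the real-valued [sup] is a genuine least upper bound. *)
Definition induced_norm (R : realType) (n : nat) (p : \bar R) (M : 'M[R]_n) : R :=
  sup [set vec_norm p (M *m x) / vec_norm p x | x in [set x : 'cV[R]_n | x != 0]].

(* Main.v *)
Require Import Defs.
From HB Require Import structures.
From mathcomp Require Import all_boot all_order all_algebra.
From mathcomp Require Import all_classical all_reals all_analysis.
From mathcomp Require Import zify ring lra.
Import Order.TTheory GRing.Theory Num.Theory.
Local Open Scope ring_scope.

(** The clamped matrix A is the fourth-order central difference operator on the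
    grid 0, ..., N, N = n + 1, with the clamped conditions u 0 = u N = 0,
    u (-1) = u 1 and u (N + 1) = u (N - 1) used to eliminate the four values
    outside 1, ..., N - 1: the reflection at the ends is what turns the corner
    entries 6 into 7 ([clamped_mx_delta4]). Hence A^-1 is the discrete Green
    function of the clamped beam, which can be written down: for a unit load at y
    it is a cubic polynomial in the position, plus a cubic spline starting at y
    whose fourth difference is the unit load. The conditions at 0 leave two free
    coefficients in the cubic, and the conditions at N determine them ([green],
    [mul_clamped_green]).

    This Green function is nonnegative. To the left of the load the spline
    vanishes, and the explicit cubic is visibly nonnegative ([green_ge0]); to the
    right of the load the symmetry of A^-1 exchanges position and load.
    Therefore the row sums of A^-1, which by symmetry are also its column sums,
    are the entries of the solution of A x = 1. That solution is again explicit,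
    s (s + 2) / 24 at position t, where s = t (N - t) ([green_mx_row_sum]). It is
    largest at t = N / 2, where s = N^2 / 4 gives N^2 (N^2 + 8) / 384, and for odd
    n this position is a grid point.

    For a nonnegative matrix, the 1-norm and the +oo-norm are the largest column
    sum and the largest row sum, and the 2-norm is at most any common bound on
    the two ([induced_norm_le_sums]), by the Schur test. *)

(** * Induced norms of nonnegative matrices *)

Lemma vec_norm_gt0 (R : realType) (n : nat) (p : \bar R) (x : 'cV[R]_n) :
  (0 < p)%E -> x != 0 -> 0 < vec_norm p x.
Proof.
move=> p0 x0; have [i xi0] : exists i, x i 0 != 0.
  apply/existsP; apply: contraNT x0; rewrite negb_exists => /forallP x0.
  by apply/eqP/colP => i; rewrite mxE; apply/eqP; have := x0 i; rewrite negbK.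
have xi : 0 < `|x i 0| by rewrite normr_gt0.
case: p p0 => [r r0| _|//] /=.
  apply: powR_gt0; rewrite (bigD1 i) //= ltr_wpDr ?powR_gt0 //.
  by apply: sumr_ge0 => j _; apply: powR_ge0.
by apply: lt_le_trans (le_bigmax _ _ i).
Qed.

Lemma induced_norm_le (R : realType) (n : nat) (p : \bar R) (M : 'M[R]_n) (C : R) :
  (0 < n)%N -> (0 < p)%E ->
  (forall x, vec_norm p (M *m x) <= C * vec_norm p x) ->
  induced_norm p M <= C.
Proof.
case: n M => // n M _ p0 MC; apply: ge_sup.
  pose e : 'cV[R]_n.+1 := const_mx 1.
  exists (vec_norm p (M *m e) / vec_norm p e), e => //=.
  by apply/eqP => /colP /(_ 0); rewrite !mxE; apply/eqP/oner_neq0.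
by move=> _ [x /= x0 <-]; rewrite ler_pdivrMr ?vec_norm_gt0.
Qed.

(** Some bound C on the quotients has to be known: the supremum of an unbounded
    set is 0 by convention. *)
Lemma le_induced_norm (R : realType) (n : nat) (p : \bar R) (M : 'M[R]_n) (C : R)
    (x : 'cV[R]_n) :
  (0 < p)%E -> (forall x, vec_norm p (M *m x) <= C * vec_norm p x) ->
  x != 0 -> vec_norm p (M *m x) / vec_norm p x <= induced_norm p M.
Proof.
move=> p0 MC x0; apply: ub_le_sup; last by exists x.
by exists C => _ [y /= y0 <-]; rewrite ler_pdivrMr ?vec_norm_gt0.
Qed.

Lemma vec_norm1E (R : realType) (n : nat) (x : 'cV[R]_n) :
  vec_norm 1%:E x = \sum_i `|x i 0|.
Proof.
rewrite /= invr1 powRr1; last by apply: sumr_ge0 => i _; apply: powR_ge0.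
by apply: eq_bigr => i _; rewrite powRr1.
Qed.

Lemma vec_norm2E (R : realType) (n : nat) (x : 'cV[R]_n) :
  vec_norm 2%:E x = Num.sqrt (\sum_i x i 0 ^+ 2).
Proof.
rewrite /= powR12_sqrt; last by apply: sumr_ge0 => i _; apply: powR_ge0.
by congr Num.sqrt; apply: eq_bigr => i _; rewrite powR_mulrn // real_normK ?num_real.
Qed.

(** Cauchy-Schwarz for the weights w: with W and S the sums of w j and of
    w j * y j, the nonnegative sum of w j * (W * y j - S) ^+ 2 is
    W * (W * (\sum_j w j * y j ^+ 2) - S ^+ 2). *)
Lemma sqr_weighted_sum_le (R : realType) (n : nat) (w y : 'I_n -> R) :
  (forall j, 0 <= w j) ->
  (\sum_j w j * y j) ^+ 2 <= (\sum_j w j) * \sum_j w j * y j ^+ 2.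
Proof.
move=> w0; set W := \sum_j w j; set S := \sum_j w j * y j.
have W0 : 0 <= W by apply: sumr_ge0.
have [W_eq0|Wn0] := eqVneq W 0.
  have wz j : w j = 0 by apply: (psumr_eq0P (fun j _ => w0 j) W_eq0).
  by rewrite W_eq0 mul0r /S big1 ?expr0n // => j _; rewrite wz mul0r.
have : 0 <= \sum_j w j * (W * y j - S) ^+ 2.
  by apply: sumr_ge0 => j _; rewrite mulr_ge0 ?sqr_ge0.
have -> : \sum_j w j * (W * y j - S) ^+ 2
  = W * (W * (\sum_j w j * y j ^+ 2) - S ^+ 2).
  rewrite (eq_bigr (fun j => W ^+ 2 * (w j * y j ^+ 2)
    - 2 * W * S * (w j * y j) + S ^+ 2 * w j));
    last by move=> j _; ring.
  by rewrite !big_split /= sumrN -!mulr_sumr -/W -/S; ring.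
by rewrite pmulr_rge0 ?subr_ge0 // lt_def Wn0.
Qed.

Lemma norm_mulmx_le (R : realType) (n : nat) (M : 'M[R]_n) (x : 'cV[R]_n) i :
  (forall i j, 0 <= M i j) -> `|(M *m x) i 0| <= \sum_j M i j * `|x j 0|.
Proof.
move=> M_ge0; rewrite mxE; apply: le_trans (ler_norm_sum _ _ _) _.
by apply: ler_sum => j _; rewrite normrM ger0_norm.
Qed.

(** For p = 1 the column sums are what counts and for p = +oo the row sums.
    For p = 2 this is the Schur test, the interpolation between the two:
    Cauchy-Schwarz with weights M i j costs one row sum, and the summation over
    i costs one column sum. *)
Lemma vec_norm_mulmx_le (R : realType) (n : nat) (M : 'M[R]_n) (C : R)
    (p : \bar R) (x : 'cV[R]_n) :
  (forall i j, 0 <= M i j) ->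
  (forall i, \sum_j M i j <= C) -> (forall j, \sum_i M i j <= C) ->
  (0 < n)%N -> p \in [:: 1%:E; 2%:E; +oo%E] ->
  vec_norm p (M *m x) <= C * vec_norm p x.
Proof.
move=> M_ge0 row_sum col_sum n0.
have C0 : 0 <= C by apply: le_trans (row_sum (Ordinal n0)); apply: sumr_ge0.
rewrite !inE => /or3P[] /eqP ->.
- rewrite !vec_norm1E.
  apply: le_trans (ler_sum _ (fun i _ => norm_mulmx_le _ _ _ x i M_ge0)) _.
  rewrite exchange_big mulr_sumr; apply: ler_sum => j _.
  by rewrite -mulr_suml ler_wpM2r.
- rewrite !vec_norm2E -[C in C * _]ger0_norm // -sqrtr_sqr -sqrtrM ?sqr_ge0 //.
  apply: ler_wsqrtr.
  apply: (@le_trans _ _ (\sum_i C * \sum_j M i j * x j 0 ^+ 2)).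
    apply: ler_sum => i _; rewrite mxE.
    apply: le_trans (sqr_weighted_sum_le _ _ _ _ (M_ge0 i)) _.
    by rewrite ler_wpM2r // sumr_ge0 // => j _; rewrite mulr_ge0 ?sqr_ge0.
  rewrite -mulr_sumr exchange_big expr2 -mulrA ler_wpM2l // mulr_sumr.
  by apply: ler_sum => j _; rewrite -mulr_suml ler_wpM2r ?sqr_ge0.
- rewrite /=; apply: bigmax_le => [|i _].
    by rewrite mulr_ge0 // bigmax_idl le_max lexx.
  apply: le_trans (norm_mulmx_le _ _ _ x i M_ge0) _.
  apply: le_trans (ler_wpM2r _ (row_sum i)); last by rewrite bigmax_idl le_max lexx.
  rewrite mulr_suml; apply: ler_sum => j _; rewrite ler_wpM2l //.
  by apply: (le_bigmax _ (fun j => `|x j 0|)).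
Qed.

Lemma induced_norm_le_sums (R : realType) (n : nat) (M : 'M[R]_n) (C : R)
    (p : \bar R) :
  (forall i j, 0 <= M i j) ->
  (forall i, \sum_j M i j <= C) -> (forall j, \sum_i M i j <= C) ->
  (0 < n)%N -> p \in [:: 1%:E; 2%:E; +oo%E] -> induced_norm p M <= C.
Proof.
move=> M_ge0 row_sum col_sum n0 pin; apply: induced_norm_le => // [|x].
  by move: pin; rewrite !inE => /or3P[] /eqP ->; rewrite ?lte_fin.
exact: vec_norm_mulmx_le.
Qed.

(** The unit vector of index j is sent to column j. *)
Lemma induced_norm1_eq (R : realType) (n : nat) (M : 'M[R]_n) (C : R) j :
  (forall i j, 0 <= M i j) ->
  (forall i, \sum_j M i j <= C) -> (forall j, \sum_i M i j <= C) ->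
  \sum_i M i j = C -> induced_norm 1%:E M = C.
Proof.
move=> M_ge0 row_sum col_sum jC; have n0 : (0 < n)%N by apply: leq_ltn_trans (ltn_ord j).
apply/le_anti; rewrite (@induced_norm_le_sums _ _ _ C) ?inE ?eqxx //=.
pose e : 'cV[R]_n := delta_mx j 0.
have e0 : e != 0.
  by apply/eqP => /colP /(_ j); rewrite !mxE !eqxx; apply/eqP/oner_neq0.
have := le_induced_norm _ _ 1%:E M C e _ _ e0.
rewrite !vec_norm1E (_ : \sum_i `|e i 0| = 1); last first.
  rewrite (bigD1 j) //= mxE !eqxx normr1 big1 ?addr0 // => i /negbTE ij.
  by rewrite mxE ij normr0.
rewrite divr1 -colE (eq_bigr (fun i => M i j)); last first.
  by move=> i _; rewrite mxE ger0_norm.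
rewrite jC; apply=> [|x]; first by rewrite lte_fin.
by apply: vec_norm_mulmx_le => //; rewrite inE eqxx.
Qed.

(** The all-ones vector is sent to the vector of row sums. *)
Lemma induced_norm_oo_eq (R : realType) (n : nat) (M : 'M[R]_n) (C : R) i :
  (forall i j, 0 <= M i j) ->
  (forall i, \sum_j M i j <= C) -> (forall j, \sum_i M i j <= C) ->
  \sum_j M i j = C -> induced_norm +oo%E M = C.
Proof.
move=> M_ge0 row_sum col_sum iC; have n0 : (0 < n)%N by apply: leq_ltn_trans (ltn_ord i).
apply/le_anti; rewrite (@induced_norm_le_sums _ _ _ C) ?inE ?eqxx ?orbT //=.
pose e : 'cV[R]_n := const_mx 1.
have e0 : e != 0.
  by apply/eqP => /colP /(_ i); rewrite !mxE; apply/eqP/oner_neq0.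
have oo0 : (0 < +oo :> \bar R)%E by [].
have bound x : vec_norm +oo%E (M *m x) <= C * vec_norm +oo%E x.
  by apply: vec_norm_mulmx_le => //; rewrite !inE eqxx !orbT.
apply: le_trans (le_induced_norm _ _ _ _ _ e oo0 bound e0).
rewrite ler_pdivlMr ?vec_norm_gt0 //.
have -> : vec_norm +oo%E e = 1.
  apply/le_anti/andP; split; rewrite /=.
    by apply: bigmax_le => // j _; rewrite mxE normr1.
  by apply: le_trans (le_bigmax _ _ i); rewrite mxE normr1.
rewrite mulr1 /=; apply: le_trans (le_bigmax _ _ i).
rewrite mxE (eq_bigr (M i)); last by move=> j _; rewrite mxE mulr1.
by rewrite iC ler_norm.
Qed.

(** * The clamped matrix as a fourth difference *)

Definition delta4 {R : realType} (g : nat -> R) (i : nat) : R :=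
  g i - 4 * g i.+1 + 6 * g i.+2 - 4 * g i.+3 + g i.+4.

Lemma sum_ord_pick (R : realType) (n k : nat) (g : nat -> R) :
  \sum_(j < n) (j.+2 == k)%:R * g j.+2 = (1 < k < n.+2)%N%:R * g k.
Proof.
have [/andP[k1 kn]|] := boolP (1 < k < n.+2)%N.
  have k2n : (k.-2 < n)%N by lia.
  rewrite (bigD1 (Ordinal k2n)) //= (_ : k.-2.+2 = k); last by lia.
  rewrite eqxx big1 ?addr0 // => j; rewrite -val_eqE /= => jk.
  by rewrite (_ : (j.+2 == k) = false) ?mul0r //; lia.
move=> nk; rewrite mul0r big1 // => j _.
by rewrite (_ : (j.+2 == k) = false) ?mul0r //; have := ltn_ord j; lia.
Qed.

(** In each term the equality test compares j.+2, the index at which the column j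
    samples a grid function, with one of the five indices of [delta4 _ i]. *)
Lemma clamped_mxE (R : realType) (n : nat) (i j : 'I_n) :
  clamped_mx R n i j =
    (j.+2 == i)%:R - 4 * (j.+2 == i.+1)%:R
    + (6 + ((i == 0%N :> nat) || (i.+1 == n))%:R) * (j.+2 == i.+2)%:R
    - 4 * (j.+2 == i.+3)%:R + (j.+2 == i.+4)%:R.
Proof.
rewrite !mxE -val_eqE /= !eqSS.
move: (nat_of_ord i) (nat_of_ord j) => a b; move: ((a == 0%N) || _) => c.
repeat (case: eqP => ? /=; try by exfalso; lia); case: c => /=; ring.
Qed.

(** The index k of g stands for the grid point k - 1, so that g starts at the
    ghost point -1 and the unknowns 1, ..., n are g 2, ..., g n.+1. The values
    g 0 and g n.+3 at the ghost points are those of the neighbours of the ends. *)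
Lemma clamped_mx_delta4 (R : realType) (n : nat) (g : nat -> R) :
  (1 < n)%N -> g 1%N = 0 -> g 0%N = g 2%N -> g n.+2 = 0 -> g n.+3 = g n.+1 ->
  clamped_mx R n *m (\col_(j < n) g j.+2) = \col_(i < n) delta4 g i.
Proof.
move=> n1 g1 g02 gn2 gn13; apply/colP => i; rewrite !mxE.
pose c : R := 6 + ((i == 0%N :> nat) || (i.+1 == n))%:R.
pose a k (j : 'I_n) := (j.+2 == k)%:R * g j.+2.
rewrite (eq_bigr (fun j => a i j - 4 * a i.+1 j + c * a i.+2 j - 4 * a i.+3 j + a i.+4 j));
  last by move=> j _; rewrite clamped_mxE mxE /a -/c; ring.
rewrite !big_split /= !sumrN -!mulr_sumr !sum_ord_pick /delta4 /c {a c}.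
have := ltn_ord i; move: (nat_of_ord i) => k kn.
(* The samples outside the range of the matrix are either zeros of g or, at a
   ghost point, copies of the neighbour of the end; the latter are what the
   additional 1 in the corner entries accounts for. *)
have left_end :
    (1 < k < n.+2)%N%:R * g k - 4 * ((1 < k.+1 < n.+2)%N%:R * g k.+1)
    = g k - (k == 0)%N%:R * g 2%N - 4 * g k.+1.
  case: k kn => [|[|k]] kn.
  - by rewrite g1 g02 /=; ring.
  - by rewrite g1 (_ : (1 < 2 < n.+2)%N) /=; [ring|lia].
  - by rewrite (_ : (1 < k.+2 < n.+2)%N) 1?(_ : (1 < k.+3 < n.+2)%N) /=; [ring|lia|lia].
have right_end :
    - 4 * ((1 < k.+3 < n.+2)%N%:R * g k.+3) + (1 < k.+4 < n.+2)%N%:R * g k.+4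
    = - 4 * g k.+3 + g k.+4 - (k.+1 == n)%N%:R * g n.+1.
  have [kn1|kn1] := eqVneq k.+1 n.
    rewrite -kn1 in gn2 gn13 *.
    by rewrite gn2 gn13 (_ : (1 < k.+4 < k.+3)%N = false) /=; [ring|lia].
  have [kn2|kn2] := eqVneq k.+2 n.
    rewrite -kn2 in gn2 *.
    by rewrite gn2 (_ : (1 < k.+3 < k.+4)%N) /=; [ring|lia].
  by rewrite (_ : (1 < k.+3 < n.+2)%N) 1?(_ : (1 < k.+4 < n.+2)%N) /=; [ring|lia|lia].
have mid : (1 < k.+2 < n.+2)%N by lia.
have corner : ((k == 0) || (k.+1 == n))%N%:R * g k.+2 =
    (k == 0)%N%:R * g 2%N + (k.+1 == n)%N%:R * g n.+1.
  by move: n1; case: eqVneq => [->|_]; case: eqVneq => [<-|_] //= _; ring.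
rewrite mid /=; lra.
Qed.

(** * The discrete Green function *)

(** The cubic (d + 1) d (d - 1) / 6 for d >= 0, continued by 0 to the left. As
    its value at 0 is 0, truncated subtraction in the argument performs the
    continuation. *)
Definition spline {R : realType} (d : nat) : R := (d%:R ^+ 3 - d%:R) / 6.

(** The response at the grid point t = k - 1 to a unit load at the grid point
    y = j + 1, where m is the distance from the load to the right end. The cubic
    lies in the span of t^2 and t^3 - t, the cubics that satisfy the clamped
    conditions at 0; its coefficients solve the 2 x 2 linear system given by the
    conditions at N, whose determinant is proportional to N^2 (N^2 + 2). *)
Definition green {R : realType} (n j k : nat) : R :=
  let N := n%:R + 1 in let y := j%:R + 1 in let m := N - y in let t := k%:R - 1 in
  m * t * (3 * y * (m * N + 1) * t - (3 * N * m - 2 * m ^+ 2 + 2) * (t ^+ 2 - 1))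
    / (6 * N * (N ^+ 2 + 2)) + spline (k - j.+2)%N.

(** The cubic (d + 1) d (d - 1) / 6 vanishes at -1, 0 and 1, so the spline
    agrees with it for d >= -1 and with 0 for d <= 1. A window of five points
    lies in one of these two ranges, where the fourth difference is 0, unless it
    is centred at d = 0; the values are then 0, 0, 0, 0, 1. *)
Lemma delta4_spline (R : realType) (i j : nat) :
  delta4 (fun k => spline (k - j.+2)%N) i = (i == j)%:R :> R.
Proof.
rewrite /delta4 /spline.
have [ij|ji|->] := ltngtP i j.
- rewrite (_ : i - _ = 0)%N 1?(_ : i.+1 - _ = 0)%N 1?(_ : i.+2 - _ = 0)%N
    1?(_ : i.+3 - _ = 0)%N; try lia.
  have : (i.+4 - j.+2 < 2)%N by lia.
  by case: (i.+4 - _)%N => [|[|//]] _ /=; field.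
- rewrite (_ : i.+1 - _ = i - j.+1)%N 1?(_ : i.+2 - _ = (i - j.+1).+1)%N
    1?(_ : i.+3 - _ = (i - j.+1).+2)%N  1?(_ : i.+4 - _ = (i - j.+1).+3)%N; try lia.
  rewrite (_ : i - j.+2 = (i - j.+1).-1)%N; last by lia.
  by case: (i - j.+1)%N => [|k] /=; field.
- rewrite (_ : j - _ = 0)%N 1?(_ : j.+1 - _ = 0)%N 1?(_ : j.+2 - _ = 0)%N
    1?(_ : j.+3 - _ = 1)%N 1?(_ : j.+4 - _ = 2)%N; try lia.
  by rewrite /=; field.
Qed.

Lemma delta4_green (R : realType) (n i j : nat) :
  delta4 (green n j) i = (i == j)%:R :> R.
Proof.
rewrite -delta4_spline /delta4 /green.
set den := 6 * _ * _.
(* The fourth difference of a cubic is 0 whatever its coefficients, even when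
   they are divided by 0. *)
have [->|den0] := eqVneq den 0; first by rewrite invr0; ring.
by field.
Qed.

Lemma green_boundary (R : realType) (n j : nat) : (j < n)%N ->
  [/\ green n j 1%N = 0 :> R, green n j 0%N = green n j 2%N :> R,
      green n j n.+2 = 0 :> R & green n j n.+3 = green n j n.+1 :> R].
Proof.
move=> jn; have [p ->] : exists p, n = (j + p).+1 by exists (n - j.+1)%N; lia.
rewrite /green /spline !subSS sub0n.
rewrite (_ : (j + p).+1 - j = p.+1)%N 1?(_ : (j + p).+2 - j = p.+2)%N
  1?(_ : j + p - j = p)%N; try lia.
rewrite -!natr1 natrD.
have : (0 : R) <= j%:R by []; have : (0 : R) <= p%:R by [].
move: (p%:R) (j%:R) => b a b0 a0 {jn}.
have e1 : a + b + 1 + 1 != 0 by lra.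
have e2 : (a + b + 1 + 1) ^+ 2 + 2 != 0 by nra.
by split; field; rewrite e1 e2.
Qed.

(** Writing t for the position, the load is at y = t + c with c >= 0. After
    substituting N = y + m, and t + c for y in the terms where cancellation
    occurs, the difference in the formula of the Green function becomes a
    polynomial in t, c, m and y with nonnegative coefficients. *)
Lemma green_ge0 (R : realType) (n i j : nat) : (i <= j < n)%N ->
  0 <= green n j i.+2 :> R.
Proof.
move=> /andP[ij jn].
rewrite /green !subSS (_ : i - j = 0)%N; last by lia.
rewrite /spline expr0n subrr mul0r addr0.
have [p ->] : exists p, n = (j + p).+1 by exists (n - j.+1)%N; lia.
have [q ->] : exists q, j = (i + q)%N by exists (j - i)%N; lia.
rewrite -[i.+2%:R]natr1 -[i.+1%:R]natr1 -[(_ + p).+1%:R]natr1 !natrD.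
have : (0 : R) <= i%:R by []; have : (0 : R) <= p%:R by []; have : (0 : R) <= q%:R by [].
move: (i%:R) (p%:R) (q%:R) => a b c c0 b0 a0.
set t : R := a + 1; set m : R := b + 1.
have t0 : 0 <= t by rewrite /t; lra.
have m0 : 0 <= m by rewrite /m; lra.
pose y := t + c; pose N := y + m.
have y0 : 0 <= y by rewrite addr_ge0.
have N0 : 0 <= N by rewrite addr_ge0.
have core : 0 <= 3 * y * (m * N + 1) * t - (3 * N * m - 2 * m ^+ 2 + 2) * (t ^+ 2 - 1).
  have -> : 3 * y * (m * N + 1) * t - (3 * N * m - 2 * m ^+ 2 + 2) * (t ^+ 2 - 1) =
     m ^+ 2 * (2 * t ^+ 2 + 3 * t * c) + 3 * t * y * m * c + t ^+ 2 + 3 * t * c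
     + m ^+ 2 + 3 * y * m + 2 by rewrite /N /y; ring.
  by rewrite !(addr_ge0, mulr_ge0, exprn_ge0).
have -> : a + c + b + 1 + 1 = N by rewrite /N /y /t /m; ring.
have -> : a + 1 + 1 - 1 = t by rewrite /t; ring.
have -> : a + c + 1 = y by rewrite /y /t; ring.
have -> : N - y = m by rewrite /N; ring.
apply: divr_ge0; first by apply: mulr_ge0 core; apply: mulr_ge0.
by rewrite !(mulr_ge0, addr_ge0, exprn_ge0).
Qed.

Definition green_mx (R : realType) (n : nat) : 'M[R]_n :=
  \matrix_(i, j) green n j i.+2.

Lemma mul_clamped_green (R : realType) (n : nat) :
  (1 < n)%N -> clamped_mx R n *m green_mx R n = 1%:M.
Proof.
move=> n1; apply/matrixP => i j.
have [g1 g02 gn gn2] := green_boundary R n j (ltn_ord j).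
have := clamped_mx_delta4 R n (green n j) n1 g1 g02 gn gn2.
have -> : \col_(k < n) green n j k.+2 = col j (green_mx R n).
  by apply/colP => k; rewrite !mxE.
rewrite colE mulmxA -colE => /colP /(_ i); rewrite [LHS]mxE => ->.
by rewrite !mxE delta4_green.
Qed.

Lemma invmx_clampedE (R : realType) (n : nat) :
  (1 < n)%N -> invmx (clamped_mx R n) = green_mx R n.
Proof.
move=> n1; have AG := mul_clamped_green R n n1; have [uA _] := mulmx1_unit AG.
by rewrite -[LHS]mulmx1 -AG mulKmx.
Qed.

Lemma green_mx_sym (R : realType) (n : nat) :
  (1 < n)%N -> (green_mx R n)^T = green_mx R n.
Proof.
move=> n1; rewrite -invmx_clampedE // trmx_inv; congr invmx.
apply/matrixP => i j; rewrite !mxE (eq_sym j) (orbC (i.+1 == j)) (orbC (i.+2 == j)).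
by case: eqVneq => // ->.
Qed.

Lemma green_mx_ge0 (R : realType) (n : nat) (i j : 'I_n) :
  (1 < n)%N -> 0 <= green_mx R n i j.
Proof.
move=> n1; have [ij|/ltnW ji] := leqP i j.
  by rewrite mxE green_ge0 ?ij /=.
by rewrite -green_mx_sym // !mxE green_ge0 ?ji /=.
Qed.

(** * Deflection under the uniform unit load *)

(** The polynomial t^2 (N - t)^2 / 24 has constant fourth difference 1 and
    vanishes at both ends; adding t (N - t) / 12 restores the equality of its
    values at t = -1 and t = 1. *)
Definition deflection {R : realType} (n k : nat) : R :=
  let s := (k%:R - 1) * (n%:R + 2 - k%:R) in s * (s + 2) / 24.

Lemma green_mx_row_sum (R : realType) (n : nat) (i : 'I_n) :
  (1 < n)%N -> \sum_j green_mx R n i j = deflection n i.+2.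
Proof.
move=> n1.
have Ad : clamped_mx R n *m (\col_(j < n) deflection n j.+2) = const_mx 1.
  rewrite clamped_mx_delta4 //; try by rewrite /deflection; field.
  by apply/colP => k; rewrite !mxE /delta4 /deflection; field.
have := congr1 (mulmx (green_mx R n)) Ad.
rewrite -invmx_clampedE // mulKmx; last first.
  by have [] := mulmx1_unit (mul_clamped_green R n n1).
move/colP/(_ i); rewrite !mxE => ->; apply: eq_bigr => j _.
by rewrite [const_mx _ _ _]mxE mulr1.
Qed.

(** By the arithmetic-geometric inequality, s = t (N - t) is at most N^2 / 4. *)
Lemma deflection_le (R : realType) (n k : nat) : (0 < k <= n.+2)%N ->
  deflection n k <= (n%:R + 1) ^+ 2 * ((n%:R + 1) ^+ 2 + 8) / 384 :> R.
Proof.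
move=> /andP[k0 kn]; rewrite /deflection.
have : 1 <= k%:R :> R by rewrite ler1n.
have : k%:R <= n%:R + 2 :> R by rewrite -natrD ler_nat addn2.
move: (k%:R) (n%:R) => a b ab a1; set s := (a - 1) * (b + 2 - a).
have s0 : 0 <= s by rewrite mulr_ge0 // subr_ge0.
have sN : s <= (b + 1) ^+ 2 / 4.
  rewrite -subr_ge0 (_ : _ - s = (a - 1 - (b + 1) / 2) ^+ 2) ?sqr_ge0 //.
  by rewrite /s; field.
have : s * (s + 2) <= ((b + 1) ^+ 2 / 4) * ((b + 1) ^+ 2 / 4 + 2).
  by apply: ler_pM => //; lra.
lra.
Qed.

(** The index n./2.+2 stands for the grid point n./2 + 1 = N / 2. *)
Lemma deflection_mid (R : realType) (n : nat) : odd n ->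
  deflection n n./2.+2 = (n%:R + 1) ^+ 2 * ((n%:R + 1) ^+ 2 + 8) / 384 :> R.
Proof.
move=> n_odd; have [h ->] : exists h, n = (h.*2).+1 by exists n./2; lia.
rewrite /deflection (_ : (h.*2).+1./2 = h); last by lia.
by rewrite -muln2 -[(h * 2).+1%:R]natr1 natrM; field.
Qed.

(** * The norms of the inverse *)

Theorem theorem3p3 (R : realType) (n : nat) (hn : (5 <= n)%N) :
  (forall p : \bar R, p \in [:: 1%:E; 2%:E; +oo%E] ->
     induced_norm p (invmx (clamped_mx R n))
       <= (n%:R + 1) ^+ 2 * ((n%:R + 1) ^+ 2 + 8) / 384) /\
  (odd n ->
   forall p : \bar R, p \in [:: 1%:E; +oo%E] ->
     induced_norm p (invmx (clamped_mx R n))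
       = (n%:R + 1) ^+ 2 * ((n%:R + 1) ^+ 2 + 8) / 384).
Proof.
have n1 : (1 < n)%N by apply: leq_trans hn.
have n0 : (0 < n)%N by apply: ltnW.
rewrite invmx_clampedE //.
have ge0 i j := green_mx_ge0 R n i j n1.
have row i : \sum_j green_mx R n i j
    <= (n%:R + 1) ^+ 2 * ((n%:R + 1) ^+ 2 + 8) / 384.
  by rewrite green_mx_row_sum // deflection_le //= !ltnS ltnW.
have rowcol j : \sum_i green_mx R n i j = \sum_i green_mx R n j i.
  by apply: eq_bigr => i _; rewrite -[in LHS]green_mx_sym // mxE.
have col j : \sum_i green_mx R n i j
    <= (n%:R + 1) ^+ 2 * ((n%:R + 1) ^+ 2 + 8) / 384 by rewrite rowcol.
split=> [p p12oo|n_odd p].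
  by apply: induced_norm_le_sums.
have mid_lt : (n./2 < n)%N by lia.
have mid : \sum_j green_mx R n (Ordinal mid_lt) j
    = (n%:R + 1) ^+ 2 * ((n%:R + 1) ^+ 2 + 8) / 384.
  by rewrite green_mx_row_sum // -deflection_mid.
rewrite !inE => /orP[] /eqP ->.
  by apply: (induced_norm1_eq _ _ _ _ (Ordinal mid_lt) ge0 row col); rewrite rowcol.
exact: (induced_norm_oo_eq _ _ _ _ (Ordinal mid_lt) ge0 row col).
Qed.
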